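(* Let $q\ge 1$ be an integer and let $x$ be a nonzero real number. Then $$\left.\frac{\partial \mathrm{Ei}_{\alpha,\beta}(x)}{\partial\beta}\right|_{\alpha=1/q,\ \beta=0}=\frac1q\sum_{h=0}^{q-1}\frac{x^{-h}}{\Gamma\left(1-\frac hq\right)}\left[S\left(1-\frac hq,\;x^q\right)-Q\left(1-\frac hq,\;x^q\right)\right].$$
   Context: The integral Mittag-Leffler function is $\mathrm{Ei}_{\alpha,\beta}(x)=\sum_{k=1}^{\infty}\frac{x^k}{k\,\Gamma(\alpha k+\beta)}$ (with $1/\Gamma=0$ at the poles of $\Gamma$). The digamma function is $\psi=\Gamma'/\Gamma$ and $(a)_k=a(a+1)\cdots(a+k-1)$ is the Pochhammer symbol. For $a\notin\{0,-1,-2,\dots\}$, $$Q(a,x):=\sum_{k=1}^\infty\frac{x^k}{(a)_k}\psi(k+a)=e^x\left[x^{1-a}\psi(a)\gamma(a,x)+\frac{x}{a^2}\,{}_2F_2\left(a,a;a+1,a+1;-x\right)\right],$$ $$S(a,x):=\sum_{k=0}^\infty\frac{x^{k+1}}{(k+a)\,(a)_{k+1}}=\frac{x}{a^2}\,{}_2F_2\left(1,a;1+a,1+a;x\right),$$ where $\gamma(a,x)=\int_0^x e^{-t}t^{a-1}dt$ is the lower incomplete gamma function ($x^{-a}\gamma(a,x)=\sum_{j\ge0}\frac{(-x)^j}{j!(a+j)}$ is entire in $x$) and ${}_2F_2$ is the generalized hypergeometric function. *)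

(* Defs.v *)
From HB Require Import structures.
From mathcomp Require Import all_boot all_order all_algebra.
From mathcomp Require Import all_classical all_reals all_analysis.
Set Implicit Arguments.
Unset Strict Implicit.
Unset Printing Implicit Defensive.
Import Order.TTheory GRing.Theory Num.Theory.
Import numFieldNormedType.Exports.
Local Open Scope classical_set_scope.
Local Open Scope ring_scope.

Definition pochhammer (R : realType) (a : R) (k : nat) : R :=
  \prod_(0 <= i < k) (a + i%:R).

(* Euler's integral of the second kind; meaningful for 0 < z. *)
Definition euler_integral (R : realType) (z : R) : R :=
  (\int[@lebesgue_measure R]_(t in `]0%R, +oo[) (t `^ (z - 1) * expR (- t)))%R.

(* The Gamma function on the real line, extended to z <= 0 through
   Gamma (z + n) = pochhammer z n * Gamma z.  The integer n is the least one
   with 0 < z + n; in particular n = 0 when 0 < z, because Num.truncn (1 - z)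
   is then 0.  At the poles 0, -1, -2, ... we have pochhammer z n = 0, hence
   Gamma z = 0 and (Gamma z)^-1 = 0 (inversion in R maps 0 to 0): this is the
   convention 1 / Gamma = 0 at the poles. *)
Definition Gamma (R : realType) (z : R) : R :=
  let n := Num.truncn (1 - z) in
  euler_integral (z + n%:R) / pochhammer z n.

Definition digamma (R : realType) (z : R) : R :=
  derive1 (@Gamma R) z / Gamma z.

Definition Ei_ML (R : realType) (alpha beta x : R) : R :=
  limn (fun n => \sum_(1 <= k < n) (x ^+ k / (k%:R * Gamma (alpha * k%:R + beta)))).

Definition Qfun (R : realType) (a x : R) : R :=
  limn (fun n => \sum_(1 <= k < n) (x ^+ k / pochhammer a k * digamma (k%:R + a))).

Definition Sfun (R : realType) (a x : R) : R :=
  limn (fun n => \sum_(0 <= k < n) (x ^+ k.+1 / ((k%:R + a) * pochhammer a k.+1))).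

(* Main.v *)
Require Import Defs.
From HB Require Import structures.
From mathcomp Require Import all_boot all_order all_algebra.
From mathcomp Require Import all_classical all_reals all_analysis.
From mathcomp Require Import measurable_realfun zify ring lra.
Import Order.TTheory GRing.Theory Num.Theory.
Import numFieldNormedType.Exports.
Local Open Scope classical_set_scope.
Local Open Scope ring_scope.

(** Write each index as k = q (n + 1) - h with 0 <= h < q and n >= 0, and put
    a = 1 - h/q, so that k = q (n + a) and k/q + beta = (a + beta) + n.  Since
    Gamma (b + n) = (b)_n Gamma b, the terms of one residue class h sum to
<<
      x^(-h)/q * 1/Gamma b * sum_n y^(n+1) / ((n + a) (b)_n),
      where b = a + beta and y = x^q.
>>
    Near beta = 0 every such b is positive, so no pole of Gamma is met, and
    Ei is a finite sum of these products ([Ei_ML_residue]).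

    Each product is differentiated at b = a.  The derivative of 1/Gamma is
    - psi/Gamma, and the series, whose terms are rational functions of b, may be
    differentiated termwise because they and their derivatives are dominated by
    the terms of an exponential series ([is_derive_residue_sum]).  At b = a we
    have (n + a) (a)_n = (a)_(n+1), and with H_n = sum_(i < n) 1/(a + i) the
    product rule gives
<<
      1/Gamma a * sum_n y^(n+1)/(a)_(n+1) * (- psi a - H_n).
>>
    The recurrence psi (a + n + 1) = psi a + H_n + 1/(a + n) turns the bracket
    into 1/(a + n) - psi (a + n + 1), whose two parts are the general terms of
    S and Q ([Sfun_sub_Qfun]).

    What this needs about Gamma is its positivity, its differentiability and its
    functional equation on the positive half line.  Differentiability comes from
    differentiating Euler's integral under the integral sign
    ([derivable_euler_integral]); the functional equation comes from integrating
    by parts over compact intervals that exhaust the half line, and it is also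
    what shows that the integral is finite ([integral_euler_integrand_lty]). *)

(** * Euler's integral: functional equation and finiteness *)

Definition euler_integrand {R : realType} (z t : R) : R := t `^ (z - 1) * expR (- t).

Lemma euler_integrand_ge0 (R : realType) (z t : R) : 0 <= euler_integrand z t.
Proof. by rewrite mulr_ge0 ?powR_ge0 ?expR_ge0. Qed.

Lemma measurable_euler_integrand (R : realType) (z : R) (D : set R) :
  measurable_fun D (fun t => (euler_integrand z t)%:E).
Proof.
apply/measurable_EFinP; apply: measurable_funTS; apply: measurable_funM.
  exact: measurable_powR.
by apply: measurableT_comp => //; exact: measurable_expR.
Qed.

(** Both ends of the half line are cut off, since for z < 1 the integrand is
    unbounded near 0; the upper end n + 2 makes the interval nondegenerate for
    n = 0 already. *)
Definition exhaustion {R : realType} (n : nat) : set R := `[n.+1%:R^-1, n.+2%:R].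

Lemma exhaustion_bounds (R : realType) (n : nat) : 0 < n.+1%:R^-1 :> R /\ n.+1%:R^-1 < n.+2%:R :> R.
Proof.
split; first by rewrite invr_gt0.
apply: (@le_lt_trans _ _ 1); last by rewrite ltr1n.
by rewrite invf_le1 // ler1n.
Qed.

Lemma nondecreasing_exhaustion (R : realType) : nondecreasing_seq (@exhaustion R).
Proof.
move=> m n mn; rewrite subsetEset => t; rewrite /exhaustion /= !in_itv/= => /andP[mt tm].
apply/andP; split.
  by apply: le_trans mt; rewrite lef_pV2 ?posrE// ler_nat ltnS.
by apply: le_trans tm _; rewrite ler_nat !ltnS.
Qed.

Lemma bigcup_exhaustion (R : realType) : \bigcup_n @exhaustion R n = `]0, +oo[%classic.
Proof.
apply/seteqP; split => t /=.
  move=> [n _]; rewrite /exhaustion /= !in_itv/= andbT => /andP[nt _].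
  by apply: lt_le_trans nt; rewrite invr_gt0.
rewrite in_itv/= andbT => t0.
exists (maxn (Num.truncn t) (Num.truncn t^-1)) => //; rewrite /exhaustion /= in_itv/=.
apply/andP; split.
  rewrite invf_ple ?posrE //; apply: ltW; apply: lt_le_trans (truncnS_gt _) _.
  by rewrite ler_nat ltnS leq_maxr.
apply: ltW; apply: lt_le_trans (truncnS_gt _) _.
by rewrite ler_nat ltnS leqW // leq_maxl.
Qed.

(** Passing to the limit in integrals over compact intervals handles at the same
    time the finiteness of the improper integral and its integration by parts. *)
Lemma cvg_integral_exhaustion (R : realType) (z : R) :
  (\int[@lebesgue_measure R]_(t in exhaustion n) (euler_integrand z t)%:E)%E @[n --> \oo] -->
  (\int[@lebesgue_measure R]_(t in `]0%R, +oo[) (euler_integrand z t)%:E)%E.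
Proof.
rewrite -bigcup_exhaustion.
apply: ge0_nondecreasing_set_cvg_integral.
- exact: nondecreasing_exhaustion.
- by move=> n; exact: measurable_itv.
- by move=> n; exact: measurable_euler_integrand.
- by move=> n t _; rewrite lee_fin euler_integrand_ge0.
Qed.

(** The boundary term at infinity: exp t >= t^(N+1)/(N+1)! beats t^z for z < N,
    leaving a multiple of 1/t. *)
Lemma cvg_powR_expR_infty (R : realType) (z : R) :
  (n.+2%:R `^ z * expR (- n.+2%:R)) @[n --> \oo] --> (0:R).
Proof.
set N := (Num.truncn z).+1.
apply: (@squeeze_cvgr _ _ _ _ (fun=> 0) (fun n => (N.+1)`!%:R * harmonic n)).
- apply: nearW => n; rewrite mulr_ge0 ?powR_ge0 ?expR_ge0//=.
  set t : R := n.+2%:R; have t1 : 1 <= t by rewrite ler1n.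
  have t0 : 0 < t by apply: lt_le_trans t1.
  apply: (@le_trans _ _ (t ^+ N * ((N.+1)`!%:R / t ^+ N.+1))).
    apply: ler_pM; rewrite ?powR_ge0 ?expR_ge0//.
      by rewrite -powR_mulrn ?(ltW t0)//; apply: (ler_powR t1); apply/ltW/truncnS_gt.
    rewrite expRN -[leRHS]invrK lef_pV2 ?posrE ?expR_gt0 ?invr_gt0 ?divr_gt0//;
      rewrite ?exprn_gt0 ?ltr0n ?fact_gt0//.
    rewrite invf_div; apply: le_trans (expR_ge1Dxn N (ltW t0)).
    by rewrite lerDr.
  have -> : t ^+ N * ((N.+1)`!%:R / t ^+ N.+1) = (N.+1)`!%:R / t.
    by rewrite exprS; field; rewrite expf_neq0 ?gt_eqF.
  by rewrite ler_pM2l ?ltr0n ?fact_gt0// lef_pV2 ?posrE// ler_nat.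
- exact: cvg_cst.
- rewrite -[X in _ --> X](mulr0 (N.+1)`!%:R); apply: cvgMr; exact: cvg_harmonic.
Qed.

Lemma integral_euler_integrand_by_parts (R : realType) (z : R) (n : nat) : 0 < z ->
  (\int[@lebesgue_measure R]_(t in exhaustion n) (euler_integrand (z + 1) t)%:E =
   (n.+1%:R^-1 `^ z * expR (- n.+1%:R^-1) - n.+2%:R `^ z * expR (- n.+2%:R))%:E +
   z%:E * \int[@lebesgue_measure R]_(t in exhaustion n) (euler_integrand z t)%:E)%E.
Proof.
move=> z0; have [a0 ab] := exhaustion_bounds R n.
rewrite /exhaustion; set a := _^-1 in a0 ab *; set b : R := n.+2%:R in ab *.
have pos (t : R) : t \in `[a, b] -> 0 < t.
  by rewrite in_itv/= => /andP[/(lt_le_trans a0)].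
have dP (p t : R) : 0 < t -> is_derive t 1 (fun s => s `^ p) (p * t `^ (p - 1)).
  by move=> t0; exact: is_derive1_powR.
have dE (t : R) : is_derive t 1 (fun s => - expR (- s)) (expR (- t)).
  by apply: is_derive_eq; rewrite mulrN1 opprK.
have cont (f df : R -> R) : (forall t : R, 0 < t -> is_derive t 1 f (df t)) ->
    derivable_oo_LRcontinuous f a b /\ {in `]a, b[, derive1 f =1 df}.
  move=> H; split; last first.
    move=> t tab; have t0 : 0 < t by apply/pos/subset_itv_oo_cc.
    by have [_ <-] := H t t0; rewrite derive1E.
  have c (t : R) : 0 < t -> {for t, continuous f}.
    by move=> t0; apply/differentiable_continuous/derivable1_diffP; have [] := H t t0.
  split.
  - move=> t tab; have t0 : 0 < t by apply/pos/subset_itv_oo_cc.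
    by have [] := H t t0.
  - by apply: cvg_at_right_filter; apply: c.
  - by apply: cvg_at_left_filter; apply: c; apply: lt_trans ab.
have [LP DP] := cont _ _ (dP z).
have [LE DE] := cont _ _ (fun t _ => dE t).
transitivity (\int[@lebesgue_measure R]_(t in `[a, b]) (t `^ z * expR (- t))%:E)%E.
  by apply: eq_integral => t _; rewrite /euler_integrand addrK.
rewrite (integration_by_parts ab _ LP DP _ LE DE).
- congr (_%:E + _)%E; first by ring.
  transitivity (- (\int[@lebesgue_measure R]_(t in `[a, b]) - (z * euler_integrand z t)%:E))%E.
    congr (- _)%E; apply: eq_integral => t _.
    by rewrite /euler_integrand mulrN mulrA EFinN.
  rewrite integral_ge0N ?oppeK; last first.
    by move=> t _; rewrite lee_fin mulr_ge0 ?euler_integrand_ge0// ltW.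
  under eq_integral do rewrite EFinM.
  rewrite ge0_integralZl_EFin//.
  + by move=> t _; rewrite lee_fin euler_integrand_ge0.
  + exact: measurable_euler_integrand.
  + exact: ltW.
- apply: continuous_in_subspaceT => t /set_mem /= /pos t0; apply: cvgM; first exact: cvg_cst.
  have [] := dP (z - 1) t t0.
  by move/derivable1_diffP/differentiable_continuous.
- apply: continuous_in_subspaceT => t _.
  by apply: continuous_comp; [exact: continuousN|exact: continuous_expR].
Qed.

(** The identity holds in the extended reals, so it does not presuppose that
    either side is finite. *)
Lemma integral_euler_integrandS (R : realType) (z : R) : 0 < z ->
  (\int[@lebesgue_measure R]_(t in `]0%R, +oo[) (euler_integrand (z + 1) t)%:E =
   z%:E * \int[@lebesgue_measure R]_(t in `]0%R, +oo[) (euler_integrand z t)%:E)%E.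
Proof.
move=> z0.
have /cvg_lim <- // := cvg_integral_exhaustion R (z + 1); apply/cvg_lim => //.
under eq_fun do rewrite integral_euler_integrand_by_parts//.
set J := (_ * _)%E; rewrite -(add0e J); apply: cvgeD.
- by rewrite fin_num_adde_defr.
- apply: cvg_EFin; first exact: nearW.
  rewrite /comp /= -[X in _ --> X]subr0; apply: cvgB; last exact: cvg_powR_expR_infty.
  apply: (@squeeze_cvgr _ _ _ _ (fun=> 0) (fun n : nat => n.+1%:R^-1 `^ z)).
  + apply: nearW => n; rewrite mulr_ge0 ?powR_ge0 ?expR_ge0//=.
    by rewrite ler_piMr ?powR_ge0// expR_le1 oppr_le0 invr_ge0.
  + exact: cvg_cst.
  + have /cvg_at_rightP := powR_cvg0 z0; apply; split => [n|]; first by rewrite invr_gt0.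
    exact: cvg_harmonic.
- by apply: cvgeZl => //; exact: cvg_integral_exhaustion.
Qed.

Lemma integral_euler_integrand1 (R : realType) :
  (\int[@lebesgue_measure R]_(t in `]0%R, +oo[) (euler_integrand 1 t)%:E = 1)%E.
Proof.
transitivity (\int[@lebesgue_measure R]_(t in `]0%R, +oo[) (expR (- t))%:E)%E.
  by apply: eq_integral => t _; rewrite /euler_integrand subrr powRr0 mul1r.
rewrite integral_itv_obnd_cbnd; last first.
  apply/measurable_EFinP/measurable_funTS.
  by apply: measurableT_comp => //; exact: measurable_expR.
have dE (t : R) : is_derive t 1 (fun s => - expR (- s)) (expR (- t)).
  by apply: is_derive_eq; rewrite mulrN1 opprK.
rewrite (@ge0_continuous_FTC2y _ _ (fun t => - expR (- t)) _ 0).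
- by rewrite oppr0 expR0 EFinN oppeK add0e.
- by move=> t _; rewrite expR_ge0.
- apply: continuous_subspaceT => t.
  by apply: continuous_comp; [exact: continuousN|exact: continuous_expR].
- by rewrite -oppr0; apply: cvgN; exact: cvgr_expR.
- by move=> t _; have [] := dE t.
- apply: cvg_at_right_filter; apply: cvgN.
  by apply: continuous_comp; [exact: continuousN|exact: continuous_expR].
- by move=> t _; have [_ <-] := dE t; rewrite derive1E.
Qed.

(** Finiteness propagates up from z = 1 to every positive integer through the
    functional equation.  For real z, t^z <= 1 + t^N bounds the integral at z + 1
    by those at 1 and N + 1, and the functional equation, now read downwards,
    gives finiteness at z, including the singular range z < 1. *)
Lemma integral_euler_integrand_lty (R : realType) (z : R) : 0 < z ->
  (\int[@lebesgue_measure R]_(t in `]0%R, +oo[) (euler_integrand z t)%:E < +oo)%E.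
Proof.
set J := fun z => (\int[@lebesgue_measure R]_(t in `]0%R, +oo[) (euler_integrand z t)%:E)%E.
have Jnat n : (J n.+1%:R < +oo)%E.
  elim: n => [|n IH]; first by rewrite /J integral_euler_integrand1 ltry.
  by rewrite -addn1 natrD /J integral_euler_integrandS// lte_mul_pinfty// lee_fin.
have Jge0 p : (0 <= J p)%E.
  by apply: integral_ge0 => t _; rewrite lee_fin euler_integrand_ge0.
move=> z0; rewrite -/(J z).
set N := (Num.truncn z).+1.
have Jz1 : (J (z + 1)%R < +oo)%E.
  apply: (@le_lt_trans _ _ (J 1%R + J N.+1%:R%R)%E); last first.
    by rewrite lte_add_pinfty// (Jnat 0).
  rewrite /J -ge0_integralD//; first last.
  - exact: measurable_euler_integrand.
  - by move=> t _; rewrite lee_fin euler_integrand_ge0.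
  - exact: measurable_euler_integrand.
  - by move=> t _; rewrite lee_fin euler_integrand_ge0.
  apply: ge0_le_integral => //.
  - by move=> t _; rewrite lee_fin euler_integrand_ge0.
  - exact: measurable_euler_integrand.
  - by apply: emeasurable_funD; exact: measurable_euler_integrand.
  - move=> t /=; rewrite in_itv/= andbT => t0; rewrite -EFinD lee_fin -mulrDl.
    rewrite ler_pM2r ?expR_gt0// addrK subrr powRr0 -natr1 addrK.
    have [t1|t1] := leP t 1.
      apply: ler_wpDr; rewrite ?powR_ge0//.
      by rewrite -(powRr0 t) ger_powR ?t0// ltW.
    apply: ler_wpDl => //; apply: (ler_powR (ltW t1)); exact/ltW/truncnS_gt.
move: Jz1; rewrite /J integral_euler_integrandS// -/(J z).
case: (eqVneq (J z) +oo%E) => [->|Jz _]; last by rewrite ltey.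
by rewrite gt0_muley ?lte_fin.
Qed.

Lemma integrable_euler_integrand (R : realType) (z : R) : 0 < z ->
  (@lebesgue_measure R).-integrable `]0, +oo[ (EFin \o euler_integrand z).
Proof.
move=> z0; apply/integrableP; split; first exact: measurable_euler_integrand.
under eq_integral => t _ do rewrite /= ger0_norm ?euler_integrand_ge0//.
exact: integral_euler_integrand_lty.
Qed.

(** On [1, 2] the integrand is at least exp(-2)/2, because t^(z-1) >= 1/t. *)
Lemma euler_integral_gt0 (R : realType) (z : R) : 0 < z -> 0 < euler_integral z.
Proof.
move=> z0; apply: (@lt_le_trans _ _ (expR (- 2) / 2 * 1)).
  by rewrite mulr1 divr_gt0 ?expR_gt0.
rewrite -lee_fin /euler_integral /Rintegral fineK; last first.
  rewrite ge0_fin_numE ?integral_euler_integrand_lty// integral_ge0// => t _.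
  by rewrite lee_fin euler_integrand_ge0.
have -> : (expR (- 2) / 2 * 1)%:E =
    (\int[@lebesgue_measure R]_(t in `[1%R, 2%R]) (expR (- 2) / 2)%:E)%E.
  rewrite integral_cst//= lebesgue_measure_itv/= lte_fin ltr1n -EFinB -EFinM.
  by congr (_ * _)%:E; ring.
apply: (@le_trans _ _ (\int[@lebesgue_measure R]_(t in `[1%R, 2%R]) (euler_integrand z t)%:E)%E).
  apply: ge0_le_integral => //.
  - exact: measurable_euler_integrand.
  - move=> t /=; rewrite in_itv/= => /andP[t1 t2]; rewrite lee_fin mulrC.
    apply: ler_pM; rewrite ?expR_ge0 ?ler_expR ?lerN2//.
    apply: (@le_trans _ _ (t `^ (-1))).
      by rewrite powR_inv1 ?lef_pV2 ?posrE; lra.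
    by apply: ler_powR => //; lra.
apply: ge0_subset_integral => //.
- exact: measurable_euler_integrand.
- by move=> t _; rewrite lee_fin euler_integrand_ge0.
- by move=> t /=; rewrite !in_itv/= andbT => /andP[t1 _]; lra.
Qed.

(** An integrable majorant of the z-derivative of the integrand, uniform for z
    near a.  For t >= 1 use ln t <= t; for t < 1 use ln s < s with s = t^(-a/4),
    which costs only a quarter of the exponent a and so keeps integrability
    at 0. *)
Lemma le_ln_euler_integrand (R : realType) (a z t : R) : 0 < a -> a / 2 < z < a + 1 -> 0 < t ->
  `|ln t * euler_integrand z t| <= euler_integrand (a + 2) t + 4 / a * euler_integrand (a / 4) t.
Proof.
move=> a0 /andP[az za] t0.
have tn0 : t != 0 by rewrite gt_eqF.
rewrite normrM (ger0_norm (@euler_integrand_ge0 R z t)).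
rewrite /euler_integrand !mulrA -mulrDl ler_pM2r ?expR_gt0//.
have [t1|t1] := leP 1 t.
  rewrite ger0_norm ?ln_ge0//; apply: ler_wpDr.
    by rewrite mulr_ge0 ?powR_ge0// divr_ge0// ltW.
  apply: (@le_trans _ _ (t * t `^ a)).
    apply: ler_pM; rewrite ?ln_ge0 ?powR_ge0//; first by rewrite ltW// ln_sublinear.
    by apply: ler_powR => //; lra.
  rewrite -{1}(@powRr1 _ t) ?(ltW t0)// -powRD ?tn0 ?implybT//.
  by apply: ler_powR => //; lra.
apply: ler_wpDl; first by rewrite powR_ge0.
have t01 : 0 < t <= 1 by rewrite t0 ltW.
apply: (@le_trans _ _ (4 / a * t `^ (- (a / 4)) * t `^ (a / 2 - 1))); last first.
  rewrite -mulrA -powRD ?tn0 ?implybT//.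
  by rewrite le_eqVlt; apply/orP; left; apply/eqP; congr (_ * _ `^ _); field.
apply: ler_pM; rewrite ?normr_ge0 ?powR_ge0//; last first.
  by rewrite ger_powR//; lra.
rewrite ltr0_norm ?ln_lt0 ?t0//.
have := ln_sublinear (powR_gt0 (- (a / 4)) t0).
rewrite ln_powR => h.
have -> : - ln t = 4 / a * (- (a / 4) * ln t) by field; rewrite gt_eqF.
by rewrite ler_pM2l ?divr_gt0//; exact: ltW.
Qed.

Lemma derivable_euler_integral (R : realType) (a : R) : 0 < a -> derivable (@euler_integral R) a 1.
Proof.
move=> a0.
have dp (t z : R) : 0 < t ->
    is_derive z 1 (fun w => euler_integrand w t) (ln t * euler_integrand z t).
  move=> t0; rewrite /euler_integrand /powR gt_eqF//.
  by apply: is_derive_eq; rewrite /GRing.scale /=; ring.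
pose G t := euler_integrand (a + 2) t + 4 / a * euler_integrand (a / 4) t.
have mI : measurable (`]0, +oo[%classic : set (measurableTypeR R)) by exact: measurable_itv.
apply: (@derivable_under_integral R _ _ (@lebesgue_measure R) euler_integrand `]0, +oo[ mI
  a (a / 2) (a + 1) _ _ _ G).
- by rewrite /= in_itv/=; lra.
- by move=> z /=; rewrite in_itv/= => /andP[az _]; apply: integrable_euler_integrand; lra.
- by move=> z t _ /=; rewrite in_itv/= andbT => t0; have [] := dp t z t0.
- move=> t; rewrite addr_ge0 ?euler_integrand_ge0// mulr_ge0 ?euler_integrand_ge0//.
  by rewrite divr_ge0// ltW.
- rewrite (_ : EFin \o G = (fun t => (euler_integrand (a + 2) t)%:E +
      (4 / a)%:E * (euler_integrand (a / 4) t)%:E)%E); last by apply/funext => t.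
  apply: integrableD => //.
    by apply: integrable_euler_integrand; lra.
  apply: integrableZl => //.
  by apply: integrable_euler_integrand; lra.
- move=> z t /=; rewrite !in_itv/= andbT => /andP[az za] t0.
  rewrite partial1of2E; have [_ ->] := dp t z t0.
  by rewrite /G le_ln_euler_integrand// az.
Qed.

(** * Gamma, digamma and the Pochhammer symbol *)

Lemma GammaE (R : realType) (z : R) : 0 < z -> Gamma z = euler_integral z.
Proof.
move=> z0; have tz : Num.truncn (1 - z) = 0%N by apply/truncn0Pn; rewrite -ltNge; lra.
by rewrite /Gamma tz addr0 /pochhammer big_nil divr1.
Qed.

Lemma Gamma_gt0 (R : realType) (z : R) : 0 < z -> 0 < Gamma z.
Proof. by move=> z0; rewrite GammaE// euler_integral_gt0. Qed.

Lemma GammaS (R : realType) (z : R) : 0 < z -> Gamma (z + 1) = z * Gamma z.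
Proof.
move=> z0; rewrite !GammaE ?addr_gt0// /euler_integral /Rintegral.
have := integral_euler_integrandS R z z0; rewrite /euler_integrand => ->.
rewrite fineM// ge0_fin_numE ?integral_euler_integrand_lty// integral_ge0// => t _.
by rewrite lee_fin euler_integrand_ge0.
Qed.

Lemma is_derive_Gamma (R : realType) (z : R) : 0 < z ->
  is_derive z 1 (@Gamma R) (derive1 (@Gamma R) z).
Proof.
move=> z0; rewrite derive1E; apply: DeriveDef => //.
apply: (@near_eq_derivable _ _ _ (@euler_integral R)); last exact: derivable_euler_integral.
by near do rewrite GammaE//; exact: lt_nbhsr.
Unshelve. all: by end_near. Qed.

Lemma is_derive_inv_Gamma (R : realType) (z : R) : 0 < z ->
  is_derive z 1 (fun w => (Gamma w)^-1) (- digamma z / Gamma z).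
Proof.
move=> z0; have G0 : Gamma z != 0 by rewrite gt_eqF ?Gamma_gt0.
have dG := is_derive_Gamma R z z0.
by apply: is_derive_eq; rewrite /digamma /GRing.scale/=; field.
Qed.

(** Logarithmic differentiation of Gamma (w + 1) = w Gamma w. *)
Lemma digammaS (R : realType) (z : R) : 0 < z -> digamma (z + 1) = digamma z + z^-1.
Proof.
move=> z0; have z10 : 0 < z + 1 by rewrite addr_gt0.
have dG := is_derive_Gamma R z z0; have dG1 := is_derive_Gamma R (z + 1) z10.
have d1 : is_derive z 1 (fun w => Gamma (w + 1)) (derive1 (@Gamma R) (z + 1)).
  have ds : is_derive z (1 : R) (fun w : R => w + 1) (1 : R) by apply: is_derive_eq; rewrite addr0.
  by have := @is_derive1_comp R (@Gamma R) (fun w : R => w + 1) z _ _ dG1 ds; rewrite mulr1.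
have d2 : is_derive z 1 (fun w => Gamma (w + 1)) (z * derive1 (@Gamma R) z + Gamma z).
  apply: (@near_eq_is_derive _ _ _ (fun w : R => w * Gamma w)).
    by near do rewrite GammaS//; exact: lt_nbhsr.
  by apply: is_derive_eq; rewrite /GRing.scale/= mulr1.
have e : derive1 (@Gamma R) (z + 1) = z * derive1 (@Gamma R) z + Gamma z.
  by have [_ <-] := d1; have [_ <-] := d2.
rewrite /digamma e GammaS//; field.
by rewrite !gt_eqF ?Gamma_gt0.
Unshelve. all: by end_near. Qed.

Definition harmonic_sum {R : realType} (b : R) (n : nat) : R := \sum_(0 <= i < n) (b + i%:R)^-1.

Lemma pochhammer0 (R : realType) (b : R) : pochhammer b 0 = 1.
Proof. by rewrite /pochhammer big_nil. Qed.

Lemma pochhammerS (R : realType) (b : R) n : pochhammer b n.+1 = pochhammer b n * (b + n%:R).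
Proof. by rewrite /pochhammer big_nat_recr. Qed.

Lemma harmonic_sumS (R : realType) (b : R) n : harmonic_sum b n.+1 =
  harmonic_sum b n + (b + n%:R)^-1.
Proof. by rewrite /harmonic_sum big_nat_recr. Qed.

Lemma pochhammer_gt0 (R : realType) (b : R) n : 0 < b -> 0 < pochhammer b n.
Proof. by move=> b0; apply: prodr_gt0 => i _; rewrite ltr_wpDr. Qed.

Lemma Gamma_addn (R : realType) (z : R) n : 0 < z -> Gamma (z + n%:R) = pochhammer z n * Gamma z.
Proof.
move=> z0; elim: n => [|n IH]; first by rewrite addr0 pochhammer0 mul1r.
by rewrite -natr1 addrA GammaS ?ltr_wpDr// IH pochhammerS; ring.
Qed.

Lemma digamma_addn (R : realType) (z : R) n : 0 < z ->
  digamma (z + n%:R) = digamma z + harmonic_sum z n.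
Proof.
move=> z0; elim: n => [|n IH]; first by rewrite /harmonic_sum big_nil !addr0.
by rewrite -natr1 addrA digammaS ?ltr_wpDr// IH harmonic_sumS addrA.
Qed.

Lemma is_derive_inv_pochhammer (R : realType) (b : R) n : 0 < b ->
  is_derive b 1 (fun c => (pochhammer c n)^-1) (- (harmonic_sum b n / pochhammer b n)).
Proof.
move=> b0; elim: n => [|n IH].
  rewrite /harmonic_sum big_nil mul0r oppr0; under eq_fun do rewrite pochhammer0.
  exact: is_derive_cst.
have bn0 : b + n%:R != 0 by rewrite gt_eqF// ltr_wpDr.
have p0 : pochhammer b n != 0 by rewrite gt_eqF// pochhammer_gt0.
under eq_fun do rewrite pochhammerS invfM.
by apply: is_derive_eq; rewrite harmonic_sumS pochhammerS /GRing.scale/=; field; rewrite bn0.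
Qed.

(** Each factor d + i is at least (i + 1)/(1 + 1/d); the product of the
    numerators is n!, so reciprocal Pochhammer symbols decay like the terms of an
    exponential series, uniformly for b >= d. *)
Lemma inv_pochhammer_le (R : realType) (d b : R) n : 0 < d -> d <= b ->
  (pochhammer b n)^-1 <= (1 + d^-1) ^+ n / n`!%:R.
Proof.
move=> d0 db; have b0 : 0 < b by apply: lt_le_trans db.
elim: n => [|n IH]; first by rewrite pochhammer0 expr0 fact0 mul1r.
have bn0 : 0 < b + n%:R by rewrite ltr_wpDr.
rewrite pochhammerS invfM factS natrM invfM exprSr.
rewrite [leRHS](_ : _ = ((1 + d^-1) ^+ n / n`!%:R) * ((1 + d^-1) / n.+1%:R)); last by ring.
apply: ler_pM => //; rewrite ?invr_ge0; [by rewrite ltW ?pochhammer_gt0|exact: ltW|].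
rewrite -[leLHS]mul1r ler_pdivrMr// mulrAC ler_pdivlMr// mul1r.
apply: (@le_trans _ _ ((1 + d^-1) * (d + n%:R))); last first.
  by apply: ler_wpM2l; [rewrite addr_ge0 ?invr_ge0 ?(ltW d0)|rewrite lerD2r].
rewrite mulrDl mul1r mulrDr mulVf ?gt_eqF// -natr1.
have : 0 <= d^-1 * n%:R by rewrite mulr_ge0// invr_ge0 ltW.
by lra.
Qed.

Lemma harmonic_sum_ge0 (R : realType) (b : R) n : 0 < b -> 0 <= harmonic_sum b n.
Proof. by move=> b0; apply: sumr_ge0 => i _; rewrite invr_ge0 ltW// ltr_wpDr. Qed.

(** The obvious bound n/d is weakened to a geometric one, which an exponential
    majorant absorbs by doubling its argument. *)
Lemma harmonic_sum_le (R : realType) (d b : R) n : 0 < d -> d <= b ->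
  harmonic_sum b n <= 2 ^+ n / d.
Proof.
move=> d0 db; apply: (@le_trans _ _ (\sum_(0 <= i < n) d^-1)).
  apply: ler_sum => i _; rewrite lef_pV2 ?posrE// ?ltr_wpDr//; last exact: lt_le_trans db.
  by apply: le_trans db _; rewrite lerDl.
rewrite sumr_const_nat subn0 -[d^-1 *+ n]mulr_natl ler_pM2r ?invr_gt0//.
by rewrite -natrX ler_nat ltnW// ltn_expl.
Qed.

(** * Series: termwise differentiation, regrouping, domination *)

Lemma summable_series (R : realType) (g : nat -> R) :
  cvgn (series (fun n => `|g n|)) -> summable setT (EFin \o g).
Proof.
move=> cg; rewrite /summable -nneseries_esumT//.
have -> : (\sum_(k <oo) `|(EFin \o g) k| = (limn (series (fun n => `|g n|)))%:E)%E.
  rewrite -EFin_lim//; apply/congr_lim/funext => n.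
  by rewrite /= /series/= -sumEFin.
by rewrite ltry.
Qed.

Lemma integrable_counting (R : realType) (g : nat -> R) :
  cvgn (series (fun n => `|g n|)) -> (@counting nat R).-integrable setT (EFin \o g).
Proof.
move=> cg; apply/integrableP; split => //.
rewrite ge0_integral_count//.
by have := summable_series _ _ cg; rewrite /summable -nneseries_esumT.
Qed.

Lemma Rintegral_counting (R : realType) (g : nat -> R) :
  cvgn (series (fun n => `|g n|)) ->
  \int[@counting nat R]_(n in setT) g n = limn (series g).
Proof.
move=> cg; rewrite /Rintegral integral_count; last exact: summable_series.
rewrite (_ : (\sum_(k <oo) (g k)%:E = (limn (series g))%:E)%E)//.
rewrite -EFin_lim; last exact: normed_cvg.
by apply/congr_lim/funext => n; rewrite /= /series/= -sumEFin.
Qed.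

(** A series is an integral for the counting measure on the natural numbers, so
    this is an instance of differentiation under the integral sign. *)
Lemma is_derive_series (R : realType) (f df : nat -> R -> R) (M : nat -> R) (u v a : R) :
  u < a < v ->
  (forall n b, u < b < v -> is_derive b 1 (f n) (df n b)) ->
  (forall b, u < b < v -> cvgn (series (fun n => `|f n b|))) ->
  (forall n b, u < b < v -> `|df n b| <= M n) -> cvgn (series M) ->
  is_derive a 1 (fun b => limn (series (f ^~ b))) (limn (series (df ^~ a))).
Proof.
move=> uav dfn cf dM cM.
have M0 n : 0 <= M n by apply: le_trans (dM n a uav).
pose F (b : R) (n : nat) := f n b.
have p1 n b : u < b < v -> partial1of2 F b n = df n b.
  by move=> ubv; rewrite partial1of2E; have [_ <-] := dfn n b ubv.
have Ia : `]u, v[%classic a by rewrite /= in_itv.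
have intF b : `]u, v[%classic b -> (@counting nat R).-integrable setT (EFin \o F b).
  by rewrite /= in_itv/= => /cf; exact: integrable_counting.
have derF b n : `]u, v[%classic b -> setT n -> derivable (F ^~ n) b 1.
  by rewrite /= in_itv/= => /(dfn n)[].
have intM : (@counting nat R).-integrable setT (EFin \o M).
  by apply: integrable_counting; under eq_fun do rewrite ger0_norm//.
have FM b n : `]u, v[%classic b -> setT n -> `|partial1of2 F b n| <= M n.
  by rewrite /= in_itv/= => ubv _; rewrite p1// dM.
have near_eq : \near a, \int[@counting nat R]_(n in setT) F a n = limn (series (f ^~ a)).
  near=> b; rewrite Rintegral_counting//; apply: cf.
  near: b; exact: near_in_itvoo.
apply: near_eq_is_derive near_eq _.
have D := derivable_under_integral measurableT Ia intF derF M0 intM FM.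
apply: DeriveDef => //.
rewrite -derive1E (differentiation_under_integral measurableT Ia intF derF M0 intM FM).
under eq_Rintegral do rewrite p1//.
rewrite Rintegral_counting//; apply: series_le_cvg cM => //.
by move=> n; exact: dM.
Unshelve. all: by end_near. Qed.

Lemma series_regroup (R : realType) (q : nat) (u : nat -> R) N :
  series u (q * N)%N = \sum_(0 <= r < q) series (fun n => u (q * n + r)%N) N.
Proof.
elim: N => [|N IH].
  by rewrite muln0 /series/= big_nil big1// => r _; rewrite big_nil.
rewrite mulnS addnC.
rewrite [series u _]/series/= (@big_cat_nat _ _ _ (q * N)%N)/= ?leq_addr//.
rewrite -[X in X + _]/(series u (q * N)%N) IH.
rewrite -{1}(add0n (q * N)%N) big_addn addKn -big_split/=.
by apply: eq_bigr => r _; rewrite /series/= big_nat_recr//= addnC.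
Qed.

(** The series of absolute values has nondecreasing partial sums that are bounded
    along the multiples of q, so the whole series converges, and its sum can be
    read off along those multiples. *)
Lemma cvg_series_regroup (R : realType) (q : nat) (u : nat -> R) : (0 < q)%N ->
  (forall r, (r < q)%N -> cvgn (series (fun n => `|u (q * n + r)%N|))) ->
  series u @ \oo --> \sum_(0 <= r < q) limn (series (fun n => u (q * n + r)%N)).
Proof.
move=> q0 cu.
have sub (w : nat -> R) : (forall r, (r < q)%N -> cvgn (series (fun n => w (q * n + r)%N))) ->
    (fun N => series w (q * N)%N) @ \oo -->
    \sum_(0 <= r < q) limn (series (fun n => w (q * n + r)%N)).
  move=> cw; rewrite big_mkord.
  rewrite (_ : (fun N => _) =
    (fun N => \sum_(r < q) series (fun n => w (q * n + r)%N) N)); last first.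
    by apply/funext => N; rewrite series_regroup big_mkord.
  by apply: cvg_big => [|r _]; [exact: add_continuous|exact: cw].
have ncu : cvgn (series (fun n => `|u n|)).
  have nd : nondecreasing_seq (series (fun n => `|u n|)).
    by apply: nondecreasing_series.
  have cN := sub (fun n => `|u n|) cu.
  apply: nondecreasing_is_cvgn => //.
  exists (\sum_(0 <= r < q) limn (series (fun n => `|u (q * n + r)%N|))) => _ [n _ <-].
  apply: (@le_trans _ _ (series (fun n => `|u n|) (q * n)%N)).
    by apply: nd; rewrite leq_pmull.
  rewrite -(cvg_lim _ cN)//.
  apply: (@nondecreasing_cvgn_le _ (fun N => series (fun n => `|u n|) (q * N)%N)).
    by move=> m k mk; apply: nd; rewrite leq_mul2l mk orbT.
  by apply/cvg_ex; eexists; exact: cN.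
have cs : cvgn (series u) by exact: normed_cvg.
have cq : (q * N)%N @[N --> \oo] --> \oo.
  move=> A [k _ kA]; exists k => // n /= kn; apply: kA => /=.
  by rewrite (leq_trans kn)// leq_pmull.
have h1 : (fun N => series u (q * N)%N) @ \oo --> limn (series u).
  by apply: (cvg_comp _ _ cq).
have h2 := sub u (fun r rq => normed_cvg (cu r rq)).
by have := cvg_unique _ h1 h2 => // <-.
Qed.

Lemma cvg_series_exp_dominated (R : realType) (C rho : R) (u : nat -> R) :
  (forall n, `|u n| <= C * (rho ^+ n / n`!%:R)) -> cvgn (series (fun n => `|u n|)).
Proof.
move=> uC.
apply: (@series_le_cvg _ _ (fun n => C * (rho ^+ n / n`!%:R))) => //.
- by move=> n; exact: le_trans (uC n).
- rewrite (_ : series _ = (fun N => C * series (exp_coeff rho) N)); last first.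
    by apply/funext => N; rewrite /series/= mulr_sumr.
  by apply: is_cvgM; [exact: is_cvg_cst|exact: is_cvg_series_exp_coeff].
Qed.

(** * Splitting the series into residue classes modulo q *)

(** The two arguments a and b agree at beta = 0 but play different roles: n + a
    is the index k divided by q, which stays fixed, while b = a + beta carries the
    differentiation variable. *)
Definition residue_term {R : realType} (a y b : R) (n : nat) : R :=
  y ^+ n.+1 / ((n%:R + a) * pochhammer b n).

Definition residue_sum {R : realType} (a y b : R) : R := limn (series (residue_term a y b)).

Lemma residue_term_le (R : realType) (a y d b : R) n : 0 < a -> 0 < d -> d <= b ->
  `|residue_term a y b n| <= `|y| / a * (((1 + d^-1) * `|y|) ^+ n / n`!%:R).
Proof.
move=> a0 d0 db; have b0 : 0 < b by apply: lt_le_trans db.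
rewrite /residue_term normrM normfV normrX normrM.
have p0 := @pochhammer_gt0 R b n b0.
have na0 : 0 < n%:R + a by rewrite ltr_wpDl.
rewrite (gtr0_norm p0) (gtr0_norm na0) exprS exprMn invfM.
rewrite [leRHS](_ : _ = `|y| * `|y| ^+ n * (a^-1 * ((1 + d^-1) ^+ n / n`!%:R))); last by ring.
apply: ler_wpM2l; first by rewrite mulr_ge0 ?exprn_ge0.
apply: ler_pM; rewrite ?invr_ge0 ?addr_ge0 ?(ltW a0) ?(ltW p0)//.
  by rewrite lef_pV2 ?posrE ?ltr_wpDl// lerDr.
exact: inv_pochhammer_le.
Qed.

Lemma residue_term_harmonic_le (R : realType) (a y d b : R) n : 0 < a -> 0 < d -> d <= b ->
  `|residue_term a y b n * harmonic_sum b n| <=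
  `|y| / a / d * ((2 * (1 + d^-1) * `|y|) ^+ n / n`!%:R).
Proof.
move=> a0 d0 db; have b0 : 0 < b by apply: lt_le_trans db.
rewrite normrM (ger0_norm (@harmonic_sum_ge0 R b n b0)).
rewrite [leRHS](_ : _ = `|y| / a * (((1 + d^-1) * `|y|) ^+ n / n`!%:R) * (2 ^+ n / d)); last first.
  by rewrite !exprMn; ring.
apply: ler_pM; rewrite ?harmonic_sum_ge0//; last exact: harmonic_sum_le.
exact: residue_term_le.
Qed.

Lemma cvg_residue_term (R : realType) (a y b : R) : 0 < a -> 0 < b ->
  cvgn (series (fun n => `|residue_term a y b n|)).
Proof.
move=> a0 b0; apply: (@cvg_series_exp_dominated _ (`|y| / a) ((1 + b^-1) * `|y|)) => n.
exact: residue_term_le.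
Qed.

Lemma cvg_residue_term_harmonic (R : realType) (a y b : R) : 0 < a -> 0 < b ->
  cvgn (series (fun n => `|residue_term a y b n * harmonic_sum b n|)).
Proof.
move=> a0 b0; apply: (@cvg_series_exp_dominated _ (`|y| / a / b) (2 * (1 + b^-1) * `|y|)) => n.
exact: residue_term_harmonic_le.
Qed.

Lemma is_derive_residue_sum (R : realType) (a y : R) : 0 < a ->
  is_derive a 1 (residue_sum a y)
    (- limn (series (fun n => residue_term a y a n * harmonic_sum a n))).
Proof.
move=> a0.
have d0 : 0 < a / 2 by rewrite divr_gt0.
set M := fun n => `|y| / a / (a / 2) * ((2 * (1 + (a / 2)^-1) * `|y|) ^+ n / n`!%:R).
pose df n b := - (residue_term a y b n * harmonic_sum b n).
have -> : - limn (series (fun n => residue_term a y a n * harmonic_sum a n)) =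
    limn (series (df ^~ a)).
  rewrite -limN; last exact/normed_cvg/cvg_residue_term_harmonic.
  by congr (limn _); apply/funext => N; rewrite /df/series/= sumrN.
(* The left end a / 2 keeps b away from the pole at 0, uniformly in n. *)
apply: (@is_derive_series _ (fun n b => residue_term a y b n) df M (a / 2) (a + 1)).
- by lra.
- move=> n b /andP[ab ba].
  have b0 : 0 < b by lra.
  have dp := @is_derive_inv_pochhammer R b n b0.
  rewrite /residue_term; under eq_fun do rewrite invfM mulrA.
  apply: is_derive_eq; rewrite /df /residue_term /GRing.scale /=.
  by rewrite invfM; ring.
- by move=> b /andP[ab ba]; apply: cvg_residue_term => //; lra.
- by move=> n b /andP[ab ba]; rewrite normrN; apply: residue_term_harmonic_le => //; lra.
- have /normed_cvg // : cvgn (series (fun n => `|M n|)).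
  apply: cvg_series_exp_dominated => n; rewrite ger0_norm; first exact: lexx.
  by rewrite mulr_ge0 ?divr_ge0 ?exprn_ge0 ?mulr_ge0 ?addr_ge0 ?invr_ge0 ?divr_ge0 ?(ltW a0)//.
Qed.

Lemma residue_termE (R : realType) (a y : R) n :
  residue_term a y a n = y ^+ n.+1 / pochhammer a n.+1.
Proof. by rewrite /residue_term pochhammerS [n%:R + a]addrC [X in _ / X]mulrC. Qed.

(** The digamma recurrence splits the general term of Q into a multiple of psi a,
    a part with a harmonic sum, and a last part with the factor 1/(n + a), which
    is exactly the general term of S and cancels. *)
Lemma Sfun_sub_Qfun (R : realType) (a y : R) : 0 < a ->
  Sfun a y - Qfun a y = - digamma a * residue_sum a y a -
    limn (series (fun n => residue_term a y a n * harmonic_sum a n)).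
Proof.
move=> a0.
have cG : cvgn (series (residue_term a y a)) by exact/normed_cvg/cvg_residue_term.
have cH : cvgn (series (fun n => residue_term a y a n * harmonic_sum a n)).
  exact/normed_cvg/cvg_residue_term_harmonic.
pose s n := residue_term a y a n / (n%:R + a).
have cS : cvgn (series s).
  apply/normed_cvg; apply: (@cvg_series_exp_dominated _ (`|y| / a / a) ((1 + a^-1) * `|y|)) => n.
  rewrite normrM normfV mulrAC; apply: ler_pM; rewrite ?invr_ge0 ?residue_term_le//.
  have na0 : 0 < n%:R + a by rewrite ltr_wpDl.
  by rewrite (gtr0_norm na0) lef_pV2 ?posrE// lerDr.
have SE : Sfun a y = limn (series s).
  congr (limn _); apply/funext => N; apply: eq_bigr => n _.
  by rewrite /s residue_termE invfM mulrA mulrAC.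
have an0 n : a + n%:R != 0 by rewrite gt_eqF// ltr_wpDr.
have QE : series (fun n => residue_term a y a n * digamma (n.+1%:R + a)) @ \oo -->
    digamma a * residue_sum a y a +
    limn (series (fun n => residue_term a y a n * harmonic_sum a n)) + limn (series s).
  rewrite (_ : series _ = (fun N => digamma a * series (residue_term a y a) N +
      series (fun n => residue_term a y a n * harmonic_sum a n) N + series s N)); last first.
    apply/funext => N; rewrite /series/= mulr_sumr -!big_split/=; apply: eq_bigr => n _.
    by rewrite [_ + a]addrC digamma_addn// harmonic_sumS /s [_ + a]addrC; ring.
  by apply: cvgD => //; apply: cvgD => //; apply: cvgM => //; exact: cvg_cst.
have -> : Qfun a y = digamma a * residue_sum a y a +
    limn (series (fun n => residue_term a y a n * harmonic_sum a n)) + limn (series s).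
  apply/cvg_lim => //; rewrite -cvg_shiftS; apply: cvg_trans QE.
  apply: near_eq_cvg; apply: nearW => N; rewrite /series/= big_add1/=.
  by apply: eq_bigr => n _; rewrite residue_termE.
by rewrite SE; ring.
Qed.

(** The product rule applied to the contribution of one residue class, in which
    Gamma occurs only through the single factor 1/Gamma b. *)
Lemma is_derive_residue_class (R : realType) (a y : R) : 0 < a ->
  is_derive a 1 (fun b => (Gamma b)^-1 * residue_sum a y b) ((Sfun a y - Qfun a y) / Gamma a).
Proof.
move=> a0; have dG := @is_derive_inv_Gamma R a a0; have dR := @is_derive_residue_sum R a y a0.
by apply: is_derive_eq; rewrite Sfun_sub_Qfun// /GRing.scale/=; ring.
Qed.

(** The condition on beta keeps every argument 1 - h/q + beta positive, the
    smallest of the numbers 1 - h/q being 1/q. *)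
Lemma Ei_ML_residue (R : realType) (q : nat) (x beta : R) : (1 <= q)%N -> x != 0 ->
  `|beta| < q%:R^-1 ->
  Ei_ML (1 / q%:R) beta x = \sum_(h < q) (x ^- h / q%:R *
    ((Gamma (1 - h%:R / q%:R + beta))^-1 *
     residue_sum (1 - h%:R / q%:R) (x ^+ q) (1 - h%:R / q%:R + beta))).
Proof.
move=> q1 x0 betaq.
have q0 : 0 < q%:R :> R by rewrite ltr0n.
pose t k : R := x ^+ k / (k%:R * Gamma (1 / q%:R * k%:R + beta)).
pose u j := t j.+1.
pose a h : R := 1 - h%:R / q%:R.
pose c h : R := x ^- h / q%:R / Gamma (a h + beta).
have a_ge h : (h < q)%N -> q%:R^-1 <= a h.
  move=> hq; rewrite /a lerBrDr -{1}[_^-1]mul1r -mulrDl ler_pdivrMr// mul1r.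
  by rewrite nat1r ler_nat.
have a_gt0 h : (h < q)%N -> 0 < a h by move=> /a_ge; apply: lt_le_trans; rewrite invr_gt0.
have ab_gt0 h : (h < q)%N -> 0 < a h + beta.
  by move=> /a_ge; move: betaq; rewrite ltr_norml; lra.
have uE h n : (h < q)%N ->
    u (q * n + (q - h.+1))%N = c h * residue_term (a h) (x ^+ q) (a h + beta) n.
  move=> hq; rewrite /u /t.
  set k := (q * n + (q - h.+1)).+1.
  have kh : (k + h = q * n.+1)%N by rewrite /k; lia.
  have xk : x ^+ k = (x ^+ q) ^+ n.+1 * x ^- h.
    by rewrite -exprM -kh exprD mulfK// expf_neq0.
  have kR : k%:R = q%:R * (n%:R + a h) :> R.
    have : k%:R + h%:R = q%:R * n.+1%:R :> R by rewrite -natrD kh natrM.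
    rewrite -natr1 /a => e; have -> : k%:R = k%:R + h%:R - h%:R :> R by ring.
    by rewrite e; field; rewrite gt_eqF.
  have -> : 1 / q%:R * k%:R + beta = a h + beta + n%:R.
    by rewrite kR; field; rewrite gt_eqF.
  have xh0 : x ^+ h != 0 by exact: expf_neq0.
  have G0 : Gamma (a h + beta) != 0 by rewrite gt_eqF// Gamma_gt0// ab_gt0.
  have p0 : pochhammer (a h + beta) n != 0 by rewrite gt_eqF// pochhammer_gt0// ab_gt0.
  have na0 : n%:R + a h != 0 by rewrite gt_eqF// ltr_wpDl// a_gt0.
  rewrite Gamma_addn ?ab_gt0// xk kR /c /residue_term; field.
  by rewrite xh0 G0 p0 na0 gt_eqF.
(* Regrouping runs over remainders r = q - 1 - h of k - 1, which reverses the
   order of the classes. *)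
have Ecvg : series u @ \oo --> \sum_(0 <= r < q) limn (series (fun n => u (q * n + r)%N)).
  apply: cvg_series_regroup => // r rq.
  have rE : r = (q - (q - r.+1).+1)%N by lia.
  rewrite rE.
  have q_r : (q - r.+1 < q)%N by lia.
  rewrite (_ : series _ = (fun N => `|c (q - r.+1)%N| * series (fun n =>
      `|residue_term (a (q - r.+1)%N) (x ^+ q) (a (q - r.+1)%N + beta) n|) N)); last first.
    by apply/funext => N; rewrite /series/= mulr_sumr; apply: eq_bigr => n _; rewrite uE// normrM.
  by apply: is_cvgM; [exact: is_cvg_cst|apply: cvg_residue_term; rewrite ?a_gt0 ?ab_gt0].
have -> : Ei_ML (1 / q%:R) beta x = \sum_(0 <= r < q) limn (series (fun n => u (q * n + r)%N)).
  apply/cvg_lim => //; rewrite -cvg_shiftS; apply: cvg_trans Ecvg.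
  by apply: near_eq_cvg; apply: nearW => N; rewrite /series/= big_add1.
rewrite big_nat_rev big_mkord; apply: eq_bigr => h _; rewrite add0n.
rewrite (_ : series _ =
  (fun N => c h * series (residue_term (a h) (x ^+ q) (a h + beta)) N)); last first.
  by apply/funext => N; rewrite /series/= mulr_sumr; apply: eq_bigr => n _; rewrite uE.
rewrite limM; [|exact: is_cvg_cst|apply/normed_cvg/cvg_residue_term; rewrite ?a_gt0 ?ab_gt0//].
by rewrite lim_cst// /c -!mulrA.
Qed.

Theorem theorem2p6 (R : realType) (q : nat) (x : R)
    (hq : (1 <= q)%N) (hx : x != 0) :
  is_derive (0 : R) (1 : R) (fun beta : R => Ei_ML (1 / q%:R) beta x)
    (1 / q%:R *
     \sum_(0 <= h < q)
        (x ^- h / Gamma (1 - h%:R / q%:R) *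
         (Sfun (1 - h%:R / q%:R) (x ^+ q) - Qfun (1 - h%:R / q%:R) (x ^+ q)))).
Proof.
have q0 : 0 < q%:R :> R by rewrite ltr0n.
pose a (h : nat) : R := 1 - h%:R / q%:R.
pose F (h : 'I_q) (b : R) : R := x ^- h / q%:R *
  ((Gamma (a h + b))^-1 * residue_sum (a h) (x ^+ q) (a h + b)).
apply: (@near_eq_is_derive _ _ _ (\sum_(h < q) F h)).
  near=> b; rewrite Ei_ML_residue ?fct_sumE//.
  by near: b; exists q%:R^-1 => [|y] /=; rewrite ?invr_gt0// sub0r normrN.
rewrite mulr_sumr big_mkord; apply: is_derive_sum => h; rewrite -/(a h).
have ah0 : 0 < a h.
  by rewrite /a subr_gt0 ltr_pdivrMr// mul1r ltr_nat.
have ds : is_derive (0 : R) (1 : R) (fun b : R => a h + b) (1 : R).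
  by apply: is_derive_eq; rewrite add0r mulr1.
have dC : is_derive (a h + 0) 1 (fun b => (Gamma b)^-1 * residue_sum (a h) (x ^+ q) b)
    ((Sfun (a h) (x ^+ q) - Qfun (a h) (x ^+ q)) / Gamma (a h)).
  by rewrite addr0; exact: is_derive_residue_class.
have dF := @is_derive1_comp R (fun b => (Gamma b)^-1 * residue_sum (a h) (x ^+ q) b)
  (fun b => a h + b) 0 _ _ dC ds.
have dZ := is_deriveZ (x ^- h / q%:R) dF.
rewrite (_ : 1 / q%:R * _ = (x ^- h / q%:R) *:
  ((Sfun (a h) (x ^+ q) - Qfun (a h) (x ^+ q)) / Gamma (a h) * 1)) //.
by rewrite /GRing.scale/=; ring.
Unshelve. all: by end_near. Qed.
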